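(* Let $\omega>0$, $T=2\pi/\omega$, $\Delta t=T/M$ with $M$ a positive integer, and consider the energy conserving two-dimensional TM Yee scheme, the grid source $J$, the discrete operator $L_h$ and the discrete filter $\Pi_h$ described in the context. Let the grid function $\nu^\infty$ be the solution to $$\widetilde{\omega}^2\nu^\infty-L_h\nu^\infty=\omega\left(\frac{1}{\epsilon}J\right),\qquad \widetilde{\omega}=\frac{\sin(\omega\Delta t/2)}{\Delta t/2}.$$ Let $\{-\lambda_j^2\}_{j=1}^N$ and $\{\psi_j\}_{j=1}^N$ be the eigenvalues and corresponding eigenfunctions of $-L_h$, with $0<\lambda_1<\lambda_2<\dots<\lambda_N$. Assume that $\omega$ is not a resonance, i.e. the relative distance to the closest resonance satisfies $$\delta_h=\min_{1\le j\le N}\frac{|\lambda_j-\omega|}{\omega}>0.$$ Then the Yee-EM-WaveHoltz iteration $\nu^{(k+1)}=\Pi_h\nu^{(k)}$, $k\ge 0$, with $\nu^{(0)}=0$, converges to $\nu^\infty$ as long as $$\Delta t\le\frac{2}{\lambda_N+2\omega/\pi},\qquad \omega\Delta t\le\min(\delta_h,1).$$ Moreover, the convergence rate is at least $\rho_h=\max(1-0.3\,\delta_h^2,\;0.6)$, i.e. $\|\nu^{(k)}-\nu^\infty\|=O(\rho_h^k)$ as $k\to\infty$.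
   Context: Grid and coefficients: a uniform two-dimensional grid with spacings $\Delta x,\Delta y>0$ on a bounded rectangle, and time levels $t^n=n\Delta t$. The permittivity values $\epsilon_{i,j}>0$ and permeability values $\mu_{i+\frac12,j},\mu_{i,j+\frac12}>0$ are real. $J=(J_z)_{i,j}$ is a given real grid function, and $\frac1\epsilon J$ is the grid function with values $(J_z)_{i,j}/\epsilon_{i,j}$. Yee scheme. The unknowns are $E^n_{i,j}$ (approximating $E_z$), $(H_x)^{n+\frac12}_{i,j+\frac12}$ and $(H_y)^{n+\frac12}_{i+\frac12,j}$: $$\epsilon_{i,j}\frac{E^{n+1}_{i,j}-E^n_{i,j}}{\Delta t}=\frac{(H_y)^{n+\frac12}_{i+\frac12,j}-(H_y)^{n+\frac12}_{i-\frac12,j}}{\Delta x}-\frac{(H_x)^{n+\frac12}_{i,j+\frac12}-(H_x)^{n+\frac12}_{i,j-\frac12}}{\Delta y}-S^{n+\frac12}(J_z)_{i,j},$$ $$\frac{(H_x)^{n+\frac12}_{i,j+\frac12}-(H_x)^{n-\frac12}_{i,j+\frac12}}{\Delta t}=-\frac{1}{\mu_{i,j+\frac12}}\frac{E^n_{i,j+1}-E^n_{i,j}}{\Delta y},\qquad \frac{(H_y)^{n+\frac12}_{i+\frac12,j}-(H_y)^{n-\frac12}_{i+\frac12,j}}{\Delta t}=\frac{1}{\mu_{i+\frac12,j}}\frac{E^n_{i+1,j}-E^n_{i,j}}{\Delta x}.$$ The source coefficients are $S^{\frac12}=\frac{\omega\Delta t}{2}$ and $S^{n+\frac12}=S^{n-\frac12}+\Delta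 t\,\omega\cos(\omega t^n)$ for $n\ge1$. Initial data. For a grid function $\nu$, set $E^0=\nu$ and $(H_x)^0=(H_y)^0=0$, with the half-step values $$(H_x)^{-\frac12}_{i,j+\frac12}=\frac{\Delta t}{2\mu_{i,j+\frac12}}\frac{E^0_{i,j+1}-E^0_{i,j}}{\Delta y},\qquad (H_y)^{-\frac12}_{i+\frac12,j}=-\frac{\Delta t}{2\mu_{i+\frac12,j}}\frac{E^0_{i+1,j}-E^0_{i,j}}{\Delta x}.$$ Operator $L_h$. For a grid function $F$, $$-L_hF_{i,j}=\frac{1}{\epsilon_{i,j}\Delta x}\Big(\frac{F_{i+1,j}-F_{i,j}}{\mu_{i+\frac12,j}\Delta x}-\frac{F_{i,j}-F_{i-1,j}}{\mu_{i-\frac12,j}\Delta x}\Big)+\frac{1}{\epsilon_{i,j}\Delta y}\Big(\frac{F_{i,j+1}-F_{i,j}}{\mu_{i,j+\frac12}\Delta y}-\frac{F_{i,j}-F_{i,j-1}}{\mu_{i,j-\frac12}\Delta y}\Big).$$ Eliminating $H_x,H_y$ from the scheme gives, for $n\ge1$, $\frac{E^{n+1}-2E^n+E^{n-1}}{\Delta t^2}+L_hE^n=-\frac1\epsilon J\,\omega\cos(\omega t^n)$. Energy conserving: the scheme is closed by homogeneous, linear, time-independent boundary conditions that conserve the discrete electromagnetic energy. The model example is the perfect electric conductor condition, $E_{i,j}=0$ at all boundary grid points with the $E$-update applied at interior grid points. All grid functions ($\nu$, $E^n$, $\frac1\epsilon J$) belong to the resulting $N$-dimensional real space, on which $L_h$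 is self-adjoint with respect to an inner product and so has a basis of eigenfunctions $\psi_1,\dots,\psi_N$. The norm $\|\cdot\|$ may be any norm on this space. Filter. With $E^n$, $0\le n\le M$, the solution of the scheme with initial data $\nu$, $$\Pi_h\nu=\frac{2\Delta t}{T}\sum_{n=0}^M\eta_n\Big(\cos(\omega t^n)-\frac14\Big)E^n,\qquad \eta_0=\eta_M=\tfrac12,\quad \eta_n=1\text{ for }1\le n\le M-1.$$ *)

(* Defs.v *)
From HB Require Import structures.
From mathcomp Require Import all_boot all_order all_algebra.
From mathcomp Require Import all_classical all_reals all_analysis.
Set Implicit Arguments.
Unset Strict Implicit.
Unset Printing Implicit Defensive.
Import Order.TTheory GRing.Theory Num.Theory.
Local Open Scope ring_scope.
Local Open Scope classical_set_scope.

(* The grid points are (i, j) with 0 <= i <= nx+1 and 0 <= j <= ny+1. The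
   E-update is applied at the points with 1 <= i <= nx and 1 <= j <= ny; the
   outermost layer carries boundary (or ghost) values, determined by the
   boundary conditions. The value of a quantity at (i+1/2, j) or (i, j+1/2) is
   stored at index (i, j), so that (i-1/2, j) is index (i.-1, j). The points
   (i+1/2, j) (the x-edges) carry H_y, the points (i, j+1/2) carry H_x. *)
Notation nodes R nx ny := 'M[R]_(nx.+2, ny.+2).
Notation xedges R nx ny := 'M[R]_(nx.+1, ny.+2).
Notation yedges R nx ny := 'M[R]_(nx.+2, ny.+1).

(* Indices are naturals; pt is only ever used with i <= p and j <= q. *)
Definition pt (R : realType) (p q : nat) (F : 'M[R]_(p.+1, q.+1)) (i j : nat)
  : R := F (inord i) (inord j).

Definition update_point (nx ny i j : nat) : bool :=
  (0 < i <= nx)%N && (0 < j <= ny)%N.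

Record yee_grid (R : realType) (nx ny : nat) := YeeGrid {
  dx : R;
  dy : R;
  eps : nodes R nx ny;
  mux : xedges R nx ny;  (* mu_{i+1/2,j} *)
  muy : yedges R nx ny;  (* mu_{i,j+1/2} *)
  dx_gt0 : 0 < dx;
  dy_gt0 : 0 < dy;
  eps_gt0 : forall i j, 0 < eps i j;
  mux_gt0 : forall i j, 0 < mux i j;
  muy_gt0 : forall i j, 0 < muy i j }.

(* Homogeneous, linear, time-independent boundary conditions, given by the
   subspaces of the electric grid functions and of the pairs (H_x, H_y) that
   satisfy them. For a perfect electric conductor, bcE is the space of grid
   functions vanishing on the outermost layer and bcH is the full space. *)
Record yee_bc (R : realType) (nx ny : nat) := YeeBC {
  bcE : {vspace nodes R nx ny};
  bcH : {vspace (yedges R nx ny * xedges R nx ny)%type} }.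

Section Yee.
Context {R : realType} {nx ny : nat}.
Variables (G : yee_grid R nx ny) (bc : yee_bc R nx ny).

Definition Dx (F : nodes R nx ny) (i j : nat) : R :=
  (pt F i.+1 j - pt F i j) / dx G.

Definition Dy (F : nodes R nx ny) (i j : nat) : R :=
  (pt F i j.+1 - pt F i j) / dy G.

(* Time derivatives of H_x and H_y according to Faraday's law. *)
Definition faraday_x (F : nodes R nx ny) : yedges R nx ny :=
  \matrix_(i, j) - ((pt (muy G) i j)^-1 * Dy F i j).

Definition faraday_y (F : nodes R nx ny) : xedges R nx ny :=
  \matrix_(i, j) ((pt (mux G) i j)^-1 * Dx F i j).

(* The boundary conditions close the scheme: electric values at the update
   points extend to exactly one grid function satisfying them, and the H-update
   preserves the conditions on H. *)
Definition bc_closes : Prop :=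
  (forall U : nodes R nx ny, exists! F, F \in bcE bc /\
     forall i j, update_point nx ny i j -> pt F i j = pt U i j) /\
  (forall F, F \in bcE bc -> (faraday_x F, faraday_y F) \in bcH bc).

(* E n is E^n, while Hx n and Hy n are the magnetic fields at level n - 1/2;
   S n is the source coefficient at level n + 1/2. *)
Definition yee_scheme (dt : R) (S : nat -> R) (J : nodes R nx ny)
    (E : nat -> nodes R nx ny) (Hx : nat -> yedges R nx ny)
    (Hy : nat -> xedges R nx ny) : Prop :=
  [/\ forall n, E n \in bcE bc,
      forall n, (Hx n, Hy n) \in bcH bc,
      forall n i j, update_point nx ny i j ->
        pt (eps G) i j * ((pt (E n.+1) i j - pt (E n) i j) / dt) =
        (pt (Hy n.+1) i j - pt (Hy n.+1) i.-1 j) / dx G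
        - (pt (Hx n.+1) i j - pt (Hx n.+1) i j.-1) / dy G
        - S n * pt J i j,
      forall n i j, (i <= nx.+1)%N -> (j <= ny)%N ->
        (pt (Hx n.+1) i j - pt (Hx n) i j) / dt =
        - ((pt (muy G) i j)^-1 * ((pt (E n) i j.+1 - pt (E n) i j) / dy G)) &
      forall n i j, (i <= nx)%N -> (j <= ny.+1)%N ->
        (pt (Hy n.+1) i j - pt (Hy n) i j) / dt =
        (pt (mux G) i j)^-1 * ((pt (E n) i.+1 j - pt (E n) i j) / dx G)].

(* Discrete electromagnetic energy at t^n, with the magnetic part taken as the
   product of the two neighbouring half levels. The weights are those of the
   quadrature: cells cut by the boundary count partially, ghost values do not
   count, and points identified by periodicity are counted once. For a perfect
   electric conductor all weights may be taken equal to 1. *)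
Definition yee_energy (wE : nodes R nx ny) (wHx : yedges R nx ny)
    (wHy : xedges R nx ny) (E : nat -> nodes R nx ny)
    (Hx : nat -> yedges R nx ny) (Hy : nat -> xedges R nx ny) (n : nat) : R :=
  dx G * dy G / 2 *
  (\sum_i \sum_j wE i j * eps G i j * E n i j ^+ 2 +
   \sum_i \sum_j wHx i j * muy G i j * (Hx n i j * Hx n.+1 i j) +
   \sum_i \sum_j wHy i j * mux G i j * (Hy n i j * Hy n.+1 i j)).

Definition energy_conserving (dt : R) : Prop :=
  exists (wE : nodes R nx ny) (wHx : yedges R nx ny) (wHy : xedges R nx ny),
  [/\ forall i j, 0 <= wE i j,
      forall i j, update_point nx ny i j -> 0 < pt wE i j,
      forall i j, 0 <= wHx i j,
      forall i j, 0 <= wHy i j &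
      forall E Hx Hy, yee_scheme dt (fun=> 0) 0 E Hx Hy ->
        forall n, yee_energy wE wHx wHy E Hx Hy n.+1 =
                  yee_energy wE wHx wHy E Hx Hy n].

Definition over_eps (J : nodes R nx ny) : nodes R nx ny :=
  \matrix_(i, j) (J i j / eps G i j).

(* The value of - L_h F at an update point. *)
Definition minus_Lh (F : nodes R nx ny) (i j : nat) : R :=
  ((pt F i.+1 j - pt F i j) / (pt (mux G) i j * dx G)
   - (pt F i j - pt F i.-1 j) / (pt (mux G) i.-1 j * dx G))
    / (pt (eps G) i j * dx G)
  + ((pt F i j.+1 - pt F i j) / (pt (muy G) i j * dy G)
   - (pt F i j - pt F i j.-1) / (pt (muy G) i j.-1 * dy G))
    / (pt (eps G) i j * dy G).

(* L_h F is the element of bcE given by the difference formula at the update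
   points; it is unique when bc_closes holds. *)
Definition Lh (F : nodes R nx ny) : nodes R nx ny :=
  xget 0 [set V | V \in bcE bc /\
    forall i j, update_point nx ny i j -> - pt V i j = minus_Lh F i j].

(* yee_source w dt n is S^{n+1/2}. *)
Fixpoint yee_source (w dt : R) (n : nat) : R :=
  if n is n'.+1 then yee_source w dt n' + dt * w * cos (w * (n%:R * dt))
  else w * dt / 2.

(* The values of Hx 0 and Hy 0, at level -1/2, encode vanishing H_x and H_y at
   time 0. *)
Definition yee_solution (w dt : R) (J nu : nodes R nx ny)
    (E : nat -> nodes R nx ny) : Prop :=
  exists (Hx : nat -> yedges R nx ny) (Hy : nat -> xedges R nx ny),
  [/\ yee_scheme dt (yee_source w dt) J E Hx Hy,
      E 0%N = nu,
      forall i j, (i <= nx.+1)%N -> (j <= ny)%N ->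
        pt (Hx 0%N) i j = dt / (2 * pt (muy G) i j) *
          ((pt nu i j.+1 - pt nu i j) / dy G) &
      forall i j, (i <= nx)%N -> (j <= ny.+1)%N ->
        pt (Hy 0%N) i j = - (dt / (2 * pt (mux G) i j) *
          ((pt nu i.+1 j - pt nu i j) / dx G))].

(* The solution with data nu; unique when bc_closes holds and dt > 0. *)
Definition yee_evolution (w dt : R) (J nu : nodes R nx ny)
    : nat -> nodes R nx ny :=
  xget (fun=> 0) [set E | yee_solution w dt J nu E].

Definition eta (M n : nat) : R := if (n == 0%N) || (n == M) then 1 / 2 else 1.

Definition Pi_h (w T dt : R) (M : nat) (J nu : nodes R nx ny) : nodes R nx ny :=
  (2 * dt / T) *: \sum_(n < M.+1)
    (eta M n * (cos (w * (n%:R * dt)) - 1 / 4)) *: yee_evolution w dt J nu n.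

Definition is_norm_on (V : {vspace nodes R nx ny}) (nrm : nodes R nx ny -> R)
    : Prop :=
  [/\ forall u, u \in V -> 0 <= nrm u,
      forall u, u \in V -> nrm u = 0 -> u = 0,
      forall a u, u \in V -> nrm (a *: u) = `|a| * nrm u &
      forall u v, u \in V -> v \in V -> nrm (u + v) <= nrm u + nrm v].

End Yee.

Definition resonance_gap (R : realType) (N : nat) (lam : 'I_N.+1 -> R) (w : R)
  : R :=
  \big[Num.min/(`|lam ord0 - w| / w)]_(j < N.+1) (`|lam j - w| / w).

(* Main.v *)
Require Import Defs.
From HB Require Import structures.
From mathcomp Require Import all_boot all_order all_algebra.
From mathcomp Require Import all_classical all_reals all_analysis.
From mathcomp Require Import ring lra.
Import Order.TTheory GRing.Theory Num.Theory.
Import numFieldNormedType.Exports.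
Local Open Scope ring_scope.
Local Open Scope classical_set_scope.

(** Eliminating the magnetic field turns the scheme into the leapfrog
    recurrence for E'' + L_h E = forcing, started with zero discrete velocity
    ([yee_second_order]). The source coefficients and the modified frequency
    wt are such that nuinf cos(w t^n) solves this recurrence exactly, so the
    error nu - nuinf evolves by the homogeneous recurrence. The N+1 eigenvalues
    are distinct and dim bcE = N+1, hence the psi_j form a basis, and the mode
    psi_j evolves as cos(n theta_j) psi_j with sin(theta_j / 2) = lam_j dt / 2
    ([leapfrog_modes]). The filter therefore leaves nuinf in place
    ([filter_gain_resonant]) and multiplies the j-th coefficient of the error
    by a number filter_gain(theta_j) ([Pi_h_modes]); after k iterations the
    error is the sum of c_j filter_gain(theta_j)^k psi_j, and everything
    reduces to the scalar inequality |filter_gain(theta_j)| <= rho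
    ([discrete_frequency]).

    For that inequality put a = w dt and x = theta / a. Summing the trapezoidal
    rule for cosines in closed form gives
      filter_gain = sin(2 pi x) / (2 pi) (C(x+1) + C(x-1) - C(x) / 2),
    where C(y) = (a/2) cot(a y / 2) is the grid version of 1/y: it is decreasing
    and lies between 1/y - a^2 y / 8 and 1/y for 0 < y <= pi / a. The time step
    restriction keeps x + 1 in this range. When x <= 0.65 or x >= 1.35, crude
    bounds on the three terms give 0.6. Otherwise the singular term
    sin(2 pi x) / (2 pi) C(x-1) stays below 1 - 2 (x-1)^2, and the other two
    terms give back only part of this loss. Finally the gap delta is measured
    with lam_j / w instead of x, but these differ by at most a^2 x^3 / 8
    ([frequency_shift]), a small fraction of delta as a <= min(delta, 1). *)

(** * Elementary bounds for sine, cosine and pi *)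

Lemma le_of_derive_ge0 {R : realType} (f df : R -> R) (b : R) :
  0 <= b -> (forall x : R, is_derive x 1 f (df x)) ->
  (forall x, 0 <= x <= b -> 0 <= df x) -> f 0 <= f b.
Proof.
move=> b0 fdf df0.
have cf : {within `[0, b], continuous f}.
  apply: continuous_subspaceT => x.
  by apply/differentiable_continuous/derivable1_diffP.
have [c + fE] := @MVT_segment R f df 0 b b0 (fun x _ => fdf x) cf.
rewrite in_itv /= => cb.
by rewrite -subr_ge0 fE subr0 mulr_ge0 ?df0.
Qed.

Lemma sin_le_id {R : realType} (x : R) : 0 <= x -> sin x <= x.
Proof.
move=> x0; rewrite -subr_ge0.
have := @le_of_derive_ge0 R (fun y => y - sin y) (fun y => 1 - cos y) x x0.
rewrite sin0 subr0; apply.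
by move=> y _; rewrite subr_ge0 cos_le1.
Qed.

Lemma mul_cos_le_sin {R : realType} (x : R) :
  0 <= x <= pi -> x * cos x <= sin x.
Proof.
move=> /andP[x0 xpi]; rewrite -subr_ge0.
have := @le_of_derive_ge0 R (fun y => sin y - y * cos y)
  (fun y => y * sin y) x x0.
rewrite sin0 mul0r subr0; apply.
  move=> y; apply: is_derive_eq.
  by rewrite /GRing.scale /=; ring.
move=> y /andP[y0 yx]; rewrite mulr_ge0// sin_ge0_pi// y0/=.
exact: le_trans xpi.
Qed.

Lemma cos_double {R : realType} (x : R) : cos x = 1 - 2 * sin (x / 2) ^+ 2.
Proof.
have {1}-> : x = (x / 2) *+ 2 by rewrite mulr2n; field.
by rewrite cos_mulr2n cos2sin2; ring.
Qed.

Lemma sin_double {R : realType} (x : R) :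
  sin x = 2 * (sin (x / 2) * cos (x / 2)).
Proof.
have {1}-> : x = (x / 2) *+ 2 by rewrite mulr2n; field.
by rewrite sin_mulr2n; ring.
Qed.

Lemma norm_sin_le {R : realType} (x : R) : `|sin x| <= `|x|.
Proof.
wlog x0 : x / 0 <= x => [H|].
  have [|x0] := leP 0 x; first exact: H.
  by rewrite -[`|x|]normrN -[`|sin x|]normrN -sinN H// oppr_ge0 ltW.
rewrite (ger0_norm x0) ler_norml sin_le_id// andbT.
have [x1|/ltW x1] := leP x 1; last by have := sin_geN1 x; lra.
have := @sin_ge0_pi R x; have := pi_ge2 R.
by rewrite x0 /= => p2 /(_ ltac:(lra)); lra.
Qed.

Lemma cos_ge_quad {R : realType} (x : R) : 1 - x ^+ 2 / 2 <= cos x.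
Proof.
rewrite cos_double.
have : sin (x / 2) ^+ 2 <= (x / 2) ^+ 2.
  by rewrite -[leLHS]real_normK ?num_real// -[leRHS]real_normK ?num_real//
     !expr2 ler_pM ?norm_sin_le.
by lra.
Qed.

(** Three is below pi because cos(3/2) > 0: start from the quadratic bound at
    3/8 and double the angle twice. *)
Lemma pi_ge3 (R : realType) : 3 <= pi :> R.
Proof.
have c1 := @cos_ge_quad R (3 / 8).
have e2 : cos (3 / 4) = 2 * cos (3 / 8) ^+ 2 - 1 :> R.
  by rewrite (_ : 3 / 4 = (3 / 8) *+ 2) ?cos_mulr2n ?mulr2n; field.
have e3 : cos (3 / 2) = 2 * cos (3 / 4) ^+ 2 - 1 :> R.
  by rewrite (_ : 3 / 2 = (3 / 4) *+ 2) ?cos_mulr2n ?mulr2n; field.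
have c2 : 72 / 100 <= cos (3 / 4) :> R.
  rewrite e2.
  have h : 93/100 - 1/1000 <= cos (3/8) :> R by lra.
  by nra.
have c3 : 0 < cos (3 / 2) :> R by rewrite e3; nra.
rewrite leNgt; apply/negP => p3.
have := @ltr_cos R (pi / 2) (3 / 2).
rewrite !in_itv /= cos_pihalf.
have := pi_ge2 R => p2.
have -> : 0 <= (pi : R) / 2 <= pi by apply/andP; split; lra.
have -> : (0:R) <= (3 : R) / 2 <= (pi : R) by apply/andP; split; lra.
move=> /(_ isT isT).
have -> : (pi : R) / 2 < 3 / 2 by lra.
by move=> h; move: c3; rewrite ltNge le_eqVlt h orbT.
Qed.

Lemma pi_lt4 (R : realType) : pi < 4 :> R.
Proof. by have := pihalf_lt2 R; lra. Qed.

(** * The gain of the discrete filter *)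

(** The grid counterpart of 1/y, to which it tends as a -> 0. *)
Definition scaled_cot {R : realType} (a y : R) : R :=
  a / 2 * (cos (a * y / 2) / sin (a * y / 2)).

Lemma scaled_cotN {R : realType} (a y : R) :
  scaled_cot a (- y) = - scaled_cot a y.
Proof.
rewrite /scaled_cot (_ : a * - y / 2 = - (a * y / 2)); last by ring.
by rewrite cosN sinN invrN !mulrN.
Qed.

Lemma scaled_cot_ge0 {R : realType} (a y : R) :
  0 < a -> 0 < y -> a * y <= pi -> 0 <= scaled_cot a y.
Proof.
move=> a0 y0 ay.
have z0 : 0 < a * y by rewrite mulr_gt0.
have p0 := pi_gt0 R.
have c0 : 0 <= cos (a * y / 2).
  by apply: cos_ge0_pihalf; apply/andP; split; lra.
have s0 : 0 < sin (a * y / 2).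
  by apply: sin_gt0_pi; apply/andP; split; lra.
by rewrite /scaled_cot mulr_ge0 ?divr_ge0 ?(ltW s0) ?(ltW a0).
Qed.

(** This is z cos z <= sin z with z = a y / 2. *)
Lemma scaled_cot_le_inv {R : realType} (a y : R) :
  0 < a -> 0 < y -> a * y <= pi -> scaled_cot a y <= y^-1.
Proof.
move=> a0 y0 ay.
have z0 : 0 < a * y by rewrite mulr_gt0.
have p0 := pi_gt0 R.
have s0 : 0 < sin (a * y / 2).
  by apply: sin_gt0_pi; apply/andP; split; lra.
have h : a * y / 2 * cos (a * y / 2) <= sin (a * y / 2).
  by apply: mul_cos_le_sin; apply/andP; split; lra.
rewrite /scaled_cot mulrA ler_pdivrMr// -(ler_pM2l y0).
rewrite [leRHS]mulrA divff ?gt_eqF// mul1r; apply: le_trans h.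
by rewrite le_eqVlt; apply/orP; left; apply/eqP; ring.
Qed.

(** From z cot z >= cos z >= 1 - z^2 / 2 with z = a y / 2. *)
Lemma scaled_cot_ge_inv {R : realType} (a y : R) :
  0 < a -> 0 < y -> a * y <= pi -> y^-1 - a ^+ 2 * y / 8 <= scaled_cot a y.
Proof.
move=> a0 y0 ay.
have z0 : 0 < a * y by rewrite mulr_gt0.
have p0 := pi_gt0 R.
have c0 : 0 <= cos (a * y / 2).
  by apply: cos_ge0_pihalf; apply/andP; split; lra.
have s0 : 0 < sin (a * y / 2).
  by apply: sin_gt0_pi; apply/andP; split; lra.
have h : sin (a * y / 2) <= a * y / 2 by apply: sin_le_id; lra.
have hc := cos_ge_quad (a * y / 2).
rewrite -(ler_pM2l y0).
apply: (@le_trans _ _ (cos (a * y / 2))).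
  apply: le_trans hc.
  rewrite le_eqVlt; apply/orP; left; apply/eqP.
  by field; rewrite gt_eqF.
have -> : y * scaled_cot a y = a * y / 2 * cos (a * y / 2) / sin (a * y / 2).
  by rewrite /scaled_cot; ring.
by rewrite ler_pdivlMr// mulrC ler_wpM2r.
Qed.

(** The difference of two cotangents is cot u - cot v =
    sin(v - u) / (sin u sin v). *)
Lemma scaled_cot_decr {R : realType} (a y z : R) :
  0 < a -> 0 < y -> y <= z -> a * z <= pi -> scaled_cot a z <= scaled_cot a y.
Proof.
move=> a0 y0 yz az.
have ay0 : 0 < a * y by rewrite mulr_gt0.
have ayz : a * y <= a * z by rewrite ler_pM2l.
have p0 := pi_gt0 R.
have sy : 0 < sin (a * y / 2).
  by apply: sin_gt0_pi; apply/andP; split; lra.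
have sz : 0 < sin (a * z / 2).
  by apply: sin_gt0_pi; apply/andP; split; lra.
rewrite /scaled_cot ler_pM2l; last by rewrite divr_gt0.
rewrite ler_pdivrMr// [leRHS]mulrAC ler_pdivlMr//.
rewrite -subr_ge0.
have -> : cos (a * y / 2) * sin (a * z / 2) - cos (a * z / 2) * sin (a * y / 2)
        = sin (a * z / 2 - a * y / 2) by rewrite sinB; ring.
by apply: sin_ge0_pi; apply/andP; split; lra.
Qed.

Lemma trapezoid_sum {R : realType} (M : nat) (f : nat -> R) : (0 < M)%N ->
  \sum_(n < M.+1) Defs.eta M n * f n = \sum_(0 <= n < M) (f n + f n.+1) / 2.
Proof.
case: M => // M _.
rewrite -(big_mkord xpredT (fun n => Defs.eta M.+1 n * f n)).
rewrite big_nat_recl // big_nat_recr //=.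
rewrite -mulr_suml big_split /=.
rewrite big_nat_recl // [X in _ = (_ + X) * _]big_nat_recr //=.
rewrite /Defs.eta /= eqxx.
rewrite (@eq_big_nat _ _ _ _ _ _ (fun n => f n.+1)); first by field.
by move=> n /andP[_ nM]; rewrite eqSS ltn_eqF// mul1r.
Qed.

(** Multiplied by 2 sin(phi/2), the average of two neighbouring cosines is
    cos(phi/2) times a difference of neighbouring sines: the sum telescopes. *)
Lemma trapezoid_cos {R : realType} (M : nat) (phi : R) : (0 < M)%N ->
  2 * sin (phi / 2) * \sum_(n < M.+1) Defs.eta M n * cos (n%:R * phi) =
  sin (M%:R * phi) * cos (phi / 2).
Proof.
move=> M0; rewrite (@trapezoid_sum R M (fun n => cos (n%:R * phi))) //.
elim: (M) => [|m IHm]; first by rewrite big_nil mul0r sin0 mulr0 mul0r.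
rewrite big_nat_recr //= mulrDr IHm.
have -> : m.+1%:R * phi = (m%:R * phi + phi / 2) + phi / 2.
  by rewrite -natr1; field.
have -> : m%:R * phi = (m%:R * phi + phi / 2) - phi / 2 by field.
rewrite subrK; move: (m%:R * phi + phi / 2) => u.
by rewrite sinB sinD cosB cosD; field.
Qed.

Lemma trapezoid_cos_closed {R : realType} (M : nat) (phi : R) : (0 < M)%N ->
  sin (phi / 2) != 0 ->
  \sum_(n < M.+1) Defs.eta M n * cos (n%:R * phi) =
  sin (M%:R * phi) / 2 * (cos (phi / 2) / sin (phi / 2)).
Proof.
move=> M0 s0; have h := @trapezoid_cos R M phi M0.
apply: (@mulfI _ (2 * sin (phi / 2))); first by rewrite mulf_neq0.
by rewrite h; field.
Qed.

(** The factor by which the filter multiplies a signal cos(n theta); here a is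
    the phase advance w dt of the resonant signal in one time step. *)
Definition filter_gain {R : realType} (a : R) (M : nat) (theta : R) : R :=
  2 / M%:R * \sum_(n < M.+1)
     Defs.eta M n * ((cos (n%:R * a) - 1 / 4) * cos (n%:R * theta)).

Lemma filter_gainE {R : realType} (a : R) (M : nat) (theta : R) :
  filter_gain a M theta = M%:R^-1 * (
   \sum_(n < M.+1) Defs.eta M n * cos (n%:R * (theta + a))
   + \sum_(n < M.+1) Defs.eta M n * cos (n%:R * (theta - a))
   - 2^-1 * \sum_(n < M.+1) Defs.eta M n * cos (n%:R * theta)).
Proof.
rewrite /filter_gain [X in _ + _ - X]mulr_sumr -big_split -sumrB /= !mulr_sumr.
apply: eq_bigr => n _.
rewrite (mulrDr n%:R) (mulrBr n%:R) cosB cosD.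
by move: (M%:R^-1) => m; field.
Qed.

Lemma sin_shift_turns {R : realType} (k : nat) (x : R) :
  sin (x + (2 * pi) *+ k) = sin x.
Proof.
by rewrite [2 * pi]mulr_natl (periodicn (@sinD2pi R)).
Qed.

(** Since M a = 2 pi, the three trapezoidal sums at theta + a, theta - a and
    theta share the factor sin(M theta) = sin(2 pi x). *)
Lemma filter_gain_closed {R : realType} (M : nat) (a x : R) : (0 < M)%N ->
  a = 2 * pi / M%:R -> 0 < x -> x != 1 -> a * (x + 1) <= pi ->
  filter_gain a M (x * a) = sin (2 * pi * x) / (2 * pi) *
    (scaled_cot a (x + 1) + scaled_cot a (x - 1) - scaled_cot a x / 2).
Proof.
move=> M0 aE x0 x1 axpi.
have p0 := pi_gt0 R.
have Mp : 0 < M%:R :> R by rewrite ltr0n.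
have a0 : 0 < a by rewrite aE divr_gt0 ?mulr_gt0.
have xa0 : 0 < x * a by rewrite mulr_gt0.
have Ma : M%:R * a = 2 * pi by rewrite aE mulrC divfK ?gt_eqF.
have sx y : 0 < y -> a * y <= pi -> sin (a * y / 2) != 0.
  move=> y0 ay; rewrite gt_eqF// sin_gt0_pi//.
  have : 0 < a * y by rewrite mulr_gt0.
  by move=> ?; apply/andP; split; lra.
have s1 : sin ((x * a + a) / 2) != 0.
  rewrite (_ : x * a + a = a * (x + 1)); last by ring.
  by apply: sx => //; lra.
have s3 : sin (x * a / 2) != 0.
  by rewrite (mulrC x); apply: sx => //; nra.
have s2 : sin ((x * a - a) / 2) != 0.
  have [x1'|x1'] := ltP 1 x.
    rewrite (_ : x * a - a = a * (x - 1)); last by ring.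
    by apply: sx; [lra|nra].
  rewrite -oppr_eq0 -sinN (_ : - ((x * a - a) / 2) = a * (1 - x) / 2).
    apply: sx; last by nra.
    by rewrite subr_gt0 lt_neqAle x1.
  by ring.
rewrite filter_gainE !trapezoid_cos_closed//.
have -> : M%:R * (x * a + a) = 2 * pi * x + 2 * pi.
  by rewrite mulrDr mulrCA Ma mulrC.
have -> : M%:R * (x * a - a) = 2 * pi * x - 2 * pi.
  by rewrite mulrBr mulrCA Ma mulrC.
have -> : M%:R * (x * a) = 2 * pi * x by rewrite mulrCA Ma mulrC.
have -> : sin (2 * pi * x + 2 * pi) = sin (2 * pi * x).
  by rewrite -[X in _ + X]mulr1n sin_shift_turns.
have -> : sin (2 * pi * x - 2 * pi) = sin (2 * pi * x).
  by rewrite -[LHS](sin_shift_turns 1) mulr1n subrK.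
rewrite /scaled_cot.
have -> : a * (x + 1) / 2 = (x * a + a) / 2 by ring.
have -> : a * (x - 1) / 2 = (x * a - a) / 2 by ring.
have -> : a * x / 2 = x * a / 2 by ring.
have -> : M%:R^-1 = a / (2 * pi) :> R.
  by rewrite aE mulrAC mulfV ?mul1r// gt_eqF// mulr_gt0.
have : pi != 0 :> R by rewrite gt_eqF.
move: (pi : R) => p pn0.
by field; rewrite s1 s2 s3 pn0.
Qed.

(** Over a full period cos^2 averages to 1/2 and cos to 0, which makes the
    normalisation 2/T exact; a <= 1 keeps 2 a below a full turn. *)
Lemma filter_gain_resonant {R : realType} (M : nat) (a : R) : (0 < M)%N ->
  a = 2 * pi / M%:R -> a <= 1 -> filter_gain a M a = 1.
Proof.
move=> M0 aE a1.
have p3 := pi_ge3 R.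
have Mp : 0 < M%:R :> R by rewrite ltr0n.
have a0 : 0 < a by rewrite aE divr_gt0 ?mulr_gt0//; lra.
have Ma : M%:R * a = 2 * pi by rewrite aE mulrC divfK ?gt_eqF.
have sin2pi' : sin (2 * pi) = 0 :> R.
  by rewrite -[2 * pi]add0r -[X in _ + X]mulr1n sin_shift_turns sin0.
rewrite filter_gainE subrr.
rewrite (@trapezoid_cos_closed _ _ (a + a))//; last first.
  rewrite gt_eqF// sin_gt0_pi//; apply/andP; split; lra.
rewrite (@trapezoid_cos_closed _ _ a)//; last first.
  rewrite gt_eqF// sin_gt0_pi//; apply/andP; split; lra.
rewrite (mulrDr M%:R a) Ma sin2pi'.
have -> : sin (2 * pi + 2 * pi) = 0 :> R.
  by rewrite -[X in _ + X]mulr1n sin_shift_turns.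
rewrite !mul0r mulr0 subr0 add0r.
rewrite (@trapezoid_sum _ M (fun n => cos (n%:R * 0)))//.
under eq_bigr do rewrite !mulr0 cos0 -[1 + 1]/2 divff//.
by rewrite sumr_const_nat subn0 -[1 *+ M]/M%:R mulVf ?gt_eqF.
Qed.

(** * Bounds on the gain *)

Lemma norm_sin_turns_le {R : realType} (y : R) : `|sin y / (2 * pi)| <= 6^-1.
Proof.
have p3 := pi_ge3 R.
rewrite normrM (@ger0_norm _ (2 * pi)^-1); last by rewrite invr_ge0; lra.
rewrite -[leRHS]mul1r; apply: ler_pM; rewrite ?sin_max//.
  by rewrite invr_ge0; lra.
by rewrite lef_pV2 ?posrE; lra.
Qed.

Lemma sin_turns_le_norm {R : realType} (x : R) :
  `|sin (2 * pi * x) / (2 * pi)| <= `|x|.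
Proof.
have p0 : 0 < 2 * pi :> R by rewrite mulr_gt0// pi_gt0.
rewrite normrM normfV (gtr0_norm p0) ler_pdivrMr//.
by apply: le_trans (norm_sin_le _) _; rewrite normrM (gtr0_norm p0) mulrC.
Qed.

(** Halving the angle twice, sin(2u) = 2 sin u cos u <= 2 u (1 - 2 sin^2(u/2)),
    and sin(u/2) >= e for u = pi e. The coefficient 2 is far from optimal but
    exceeds what the other terms of the gain can add. *)
Lemma sin_turns_near0 {R : realType} (e : R) : 0 <= e <= 35 / 100 ->
  0 <= sin (2 * pi * e) / (2 * pi) <= e * (1 - 2 * e ^+ 2).
Proof.
move=> /andP[e0 e1]; have p3 := pi_ge3 R; have p4 := pi_lt4 R.
set p : R := pi in p3 p4 *.
have pe0 : 0 <= p * e by apply: mulr_ge0; lra.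
have pe1 : p * e <= 35 / 100 * p by rewrite mulrC ler_wpM2r//; lra.
apply/andP; split.
  apply: divr_ge0; last by lra.
  by apply: sin_ge0_pi; rewrite -/p; apply/andP; split; lra.
rewrite ler_pdivrMr; last by lra.
rewrite sin_double.
have -> : 2 * p * e / 2 = p * e by field.
rewrite (cos_double (p * e)).
set v := p * e / 2.
have v0 : 0 <= v by rewrite /v; lra.
have v1 : v <= 7 / 10 by rewrite /v; lra.
have cv : 3 / 4 <= cos v by have := cos_ge_quad v; nra.
have sv : 3 / 4 * v <= sin v.
  apply: le_trans (_ : v * cos v <= _); first by rewrite mulrC ler_wpM2l.
  by apply: mul_cos_le_sin; rewrite -/p; apply/andP; split; lra.
have p3e : 3 * e <= p * e by rewrite ler_wpM2r.
have se : e <= sin v by apply: le_trans sv; rewrite /v; lra.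
have s2 : e ^+ 2 <= sin v ^+ 2 by rewrite !expr2 ler_pM.
have s1 : sin (p * e) <= p * e by exact: sin_le_id.
have c0 : 0 <= 1 - 2 * sin v ^+ 2.
  rewrite -cos_double; apply: cos_ge0_pihalf; rewrite -/p.
  by apply/andP; split; lra.
apply: (@le_trans _ _ (2 * (p * e * (1 - 2 * sin v ^+ 2)))).
  by rewrite ler_pM2l// ler_wpM2r.
rewrite (_ : e * _ * _ = 2 * (p * e * (1 - 2 * e ^+ 2))); last by ring.
by rewrite ler_pM2l// ler_wpM2l//; lra.
Qed.

(** The leapfrog frequency x exceeds the exact one, y, by a dispersion error
    that is of second order in the time step. *)
Lemma frequency_shift {R : realType} (a x y : R) :
  0 < a -> 0 < x -> a * x <= pi -> sin (a * x / 2) = a * y / 2 ->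
  y <= x /\ x - y <= a ^+ 2 * x ^+ 3 / 8.
Proof.
move=> a0 x0 ax sE.
have ax0 : 0 < a * x by rewrite mulr_gt0.
have h1 : sin (a * x / 2) <= a * x / 2 by apply: sin_le_id; lra.
have h2 : a * x / 2 * cos (a * x / 2) <= sin (a * x / 2).
  by apply: mul_cos_le_sin; apply/andP; split; lra.
have h3 := cos_ge_quad (a * x / 2).
have h4 : a * x / 2 * (1 - (a * x / 2) ^+ 2 / 2) <= a * y / 2.
  by rewrite -sE; apply: le_trans h2; rewrite ler_pM2l//; lra.
split; first by rewrite -(ler_pM2l a0); lra.
rewrite -(ler_pM2l a0).
have -> : a * (a ^+ 2 * x ^+ 3 / 8) =
  2 * (a * x / 2 - a * x / 2 * (1 - (a * x / 2) ^+ 2 / 2)) by field.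
by lra.
Qed.

(** The critical point is x = 0, where the gain tends to -1/2 while C(x) / 2 is
    unbounded. Below 0.18 the sine factor is bounded by x, which absorbs C(x);
    above, the bound 1/6 on the sine factor suffices. *)
Lemma filter_gain_far_left {R : realType} (M : nat) (a x : R) : (0 < M)%N ->
  a = 2 * pi / M%:R -> a <= 1 -> 0 < x <= 65 / 100 -> a * (x + 1) <= pi ->
  `|filter_gain a M (x * a)| <= 6 / 10.
Proof.
move=> M0 aE a1 /andP[x0 x1] axpi.
have a0 : 0 < a by rewrite aE divr_gt0 ?ltr0n// mulr_gt0 ?pi_gt0.
have h1 : 0 < 1 - x by lra.
have h2 : 0 < 1 + x by lra.
rewrite filter_gain_closed//; last by rewrite lt_eqF//; lra.
rewrite -(opprB 1 x) scaled_cotN (addrC x 1).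
have c1u := @scaled_cot_le_inv _ a (1 - x) a0 h1 ltac:(nra).
have c12 := @scaled_cot_decr _ a (1 - x) (1 + x) a0 h1 ltac:(lra) ltac:(lra).
have c2l := @scaled_cot_ge_inv _ a (1 + x) a0 h2 ltac:(lra).
have c3u := @scaled_cot_le_inv _ a x a0 x0 ltac:(nra).
have c3l := @scaled_cot_ge0 _ a x a0 x0 ltac:(nra).
have a2 : a ^+ 2 <= 1 by rewrite expr_le1 // ltW.
have ea : a ^+ 2 * (1 + x) / 8 <= (1 + x) / 8 by nra.
move: (scaled_cot a (1 - x)) (scaled_cot a (1 + x)) (scaled_cot a x)
  c1u c12 c2l c3u c3l.
move=> c1 c2 c3 c1u c12 c2l c3u c3l.
rewrite normrM (@ler0_norm _ (c2 - c1 - c3 / 2)); last by lra.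
have dE : (1 - x)^-1 - (1 + x)^-1 = 2 * x / ((1 - x) * (1 + x)).
  by field; rewrite !gt_eqF.
have h12 : 0 < (1 - x) * (1 + x) by rewrite mulr_gt0.
have k6 := norm_sin_turns_le (2 * pi * x).
have k0 := normr_ge0 (sin (2 * pi * x) / (2 * pi)).
have kx : `|sin (2 * pi * x) / (2 * pi)| <= x.
  by rewrite -[leRHS]ger0_norm ?sin_turns_le_norm ?ltW.
move: (`|_|) k6 k0 kx => k k6 k0 kx.
have [xs|xl] := leP x (18 / 100).
  have kc : k * c3 <= 1.
    apply: (@le_trans _ _ (x * x^-1)); last by rewrite divff ?gt_eqF.
    exact: ler_pM.
  have d : (1 - x)^-1 - (1 + x)^-1 <= 21 / 10 * x.
    by rewrite dE ler_pdivrMr//; nra.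
  have kd : k * (c1 - c2) <= 1 / 10.
    apply: (@le_trans _ _ (18 / 100 * (53 / 100))); last by lra.
    by apply: ler_pM; lra.
  by lra.
have d : (1 - x)^-1 - (1 + x)^-1 <= 35 / 10 * x.
  by rewrite dE ler_pdivrMr//; nra.
(* The convex function 1/(2x) lies below a line that exceeds its chord over
   [0.18, 0.65]. *)
have ix : x^-1 / 2 <= 355 / 100 - 425 / 100 * x.
  by rewrite -(ler_pM2l x0) mulrA divff ?gt_eqF//; nra.
have : k * (c1 - c2 + c3 / 2) <= 6^-1 * (36 / 10).
  by apply: ler_pM; lra.
by lra.
Qed.

(** Monotonicity of C makes the bracket nonnegative and at most
    C(x-1) + C(x+1) / 2 <= 3 + 1/4. *)
Lemma filter_gain_far_right {R : realType} (M : nat) (a x : R) : (0 < M)%N ->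
  a = 2 * pi / M%:R -> 135 / 100 <= x -> a * (x + 1) <= pi ->
  `|filter_gain a M (x * a)| <= 6 / 10.
Proof.
move=> M0 aE x1 axpi.
have a0 : 0 < a by rewrite aE divr_gt0 ?ltr0n// mulr_gt0 ?pi_gt0.
have h0 : 0 < x by lra.
have h1 : 0 < x - 1 by lra.
have h2 : 0 < x + 1 by lra.
rewrite filter_gain_closed//; last by rewrite gt_eqF//; lra.
have c1u := @scaled_cot_le_inv _ a (x - 1) a0 h1 ltac:(nra).
have c31 := @scaled_cot_decr _ a (x - 1) x a0 h1 ltac:(lra) ltac:(nra).
have c23 := @scaled_cot_decr _ a x (x + 1) a0 h0 ltac:(lra) ltac:(nra).
have c2l := @scaled_cot_ge0 _ a (x + 1) a0 h2 axpi.
have c2u := @scaled_cot_le_inv _ a (x + 1) a0 h2 axpi.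
have i1 : (x - 1)^-1 <= 3.
  by rewrite -[leRHS]invrK lef_pV2 ?posrE//; lra.
have i2 : (x + 1)^-1 <= 1 / 2.
  by rewrite div1r lef_pV2 ?posrE//; lra.
rewrite normrM (@ger0_norm _ (_ + _ - _)); last by lra.
apply: (@le_trans _ _ (6^-1 * (36 / 10))); last by lra.
by apply: ler_pM; rewrite ?norm_sin_turns_le//; lra.
Qed.

(** The singular term loses 2 e^2, while 1/(2+e) - 1/(2(1+e)) <= e/4 and the
    grid error of C(x) / 2 is O(a^2), hence O(e) by a <= e. Multiplied by the
    sine factor, itself at most e, these give back less than 0.34 e^2. *)
Lemma filter_gain_near_right {R : realType} (M : nat) (a e : R) : (0 < M)%N ->
  a = 2 * pi / M%:R -> a <= 1 -> a <= e -> e <= 35 / 100 ->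
  a * (1 + e + 1) <= pi ->
  - (6 / 10) <= filter_gain a M ((1 + e) * a) <= 1 - 3 / 10 * e ^+ 2.
Proof.
move=> M0 aE a1 ae e1 axpi.
have a0 : 0 < a by rewrite aE divr_gt0 ?ltr0n// mulr_gt0 ?pi_gt0.
have e0 : 0 < e by lra.
have h0 : 0 < 1 + e by lra.
have h2 : 0 < 2 + e by lra.
rewrite filter_gain_closed//; last by rewrite gt_eqF//; lra.
rewrite (_ : 1 + e - 1 = e); last by ring.
have -> : sin (2 * pi * (1 + e)) = sin (2 * pi * e).
  by rewrite mulrDr mulr1 addrC -[X in _ + X]mulr1n sin_shift_turns.
rewrite (_ : 1 + e + 1 = 2 + e) in axpi *; last by ring.
have c1u := @scaled_cot_le_inv _ a e a0 e0 ltac:(nra).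
have c1l := @scaled_cot_ge0 _ a e a0 e0 ltac:(nra).
have c2u := @scaled_cot_le_inv _ a (2 + e) a0 h2 axpi.
have c2l := @scaled_cot_ge0 _ a (2 + e) a0 h2 axpi.
have c3l := @scaled_cot_ge_inv _ a (1 + e) a0 h0 ltac:(nra).
have c3p := @scaled_cot_ge0 _ a (1 + e) a0 h0 ltac:(nra).
have c3u := @scaled_cot_le_inv _ a (1 + e) a0 h0 ltac:(nra).
have k6 := le_trans (ler_norm _) (norm_sin_turns_le (2 * pi * e)).
have /andP[k0 k1] := @sin_turns_near0 _ e ltac:(lra).
move: (sin _ / _) k6 k0 k1 => k k6 k0 k1.
move: (scaled_cot a e) (scaled_cot a (2 + e)) (scaled_cot a (1 + e))
  c1u c1l c2u c2l c3l c3p c3u.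
move=> c1 c2 c3 c1u c1l c2u c2l c3l c3p c3u.
have iE : (2 + e)^-1 - (1 + e)^-1 / 2 = e / (2 * (1 + e) * (2 + e)).
  by field; rewrite !gt_eqF.
have i1 : e / (2 * (1 + e) * (2 + e)) <= e / 4.
  by apply: ler_wpM2l; rewrite ?lef_pV2 ?posrE; nra.
have i2 : (1 + e)^-1 <= 1 by rewrite invf_le1//; lra.
have ea : a ^+ 2 * (1 + e) / 16 <= e * (135 / 100) / 16.
  have : a ^+ 2 <= e by nra.
  by nra.
have kc : k * c1 <= 1 - 2 * e ^+ 2.
  apply: (@le_trans _ _ (e * (1 - 2 * e ^+ 2) * e^-1)); first exact: ler_pM.
  by rewrite mulrAC divff ?mul1r ?gt_eqF.
have ke : k <= e by nra.
have kd : k * (c2 - c3 / 2) <= e * (34 / 100 * e).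
  have [d0|d0] := leP 0 (c2 - c3 / 2); last by nra.
  by apply: ler_pM; lra.
apply/andP; split; last by nra.
have : k * (c3 / 2) <= 6^-1 * (1 / 2) by apply: ler_pM; lra.
have : 0 <= k * c1 by apply: mulr_ge0.
have : 0 <= k * c2 by apply: mulr_ge0.
by lra.
Qed.

(** The mirror image of the case x > 1: with x = 1 - f, the sine factor and
    C(x-1) both change sign. The remaining difference C(x) / 2 - C(x+1) is at
    most 0.47 f plus a grid error a^2 / 4, which the bound on a^2 makes O(f). *)
Lemma filter_gain_near_left {R : realType} (M : nat) (a f : R) : (0 < M)%N ->
  a = 2 * pi / M%:R -> a ^+ 2 <= 8 / 7 * f -> 0 < f -> f <= 35 / 100 ->
  a * (2 - f) <= pi ->
  - (6 / 10) <= filter_gain a M ((1 - f) * a) <= 1 - f ^+ 2.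
Proof.
move=> M0 aE af f0 f1 axpi.
have a0 : 0 < a by rewrite aE divr_gt0 ?ltr0n// mulr_gt0 ?pi_gt0.
have h0 : 0 < 1 - f by lra.
have h2 : 0 < 2 - f by lra.
rewrite filter_gain_closed//; [|by rewrite lt_eqF//; lra|by lra].
rewrite (_ : 1 - f - 1 = - f); last by ring.
have -> : sin (2 * pi * (1 - f)) = - sin (2 * pi * f).
  rewrite mulrBr mulr1 addrC -[X in _ + X]mulr1n sin_shift_turns.
  by rewrite sinN.
rewrite scaled_cotN (_ : 1 - f + 1 = 2 - f); last by ring.
have c1u := @scaled_cot_le_inv _ a f a0 f0 ltac:(nra).
have c1l := @scaled_cot_ge0 _ a f a0 f0 ltac:(nra).
have c2u := @scaled_cot_le_inv _ a (2 - f) a0 h2 axpi.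
have c2l := @scaled_cot_ge_inv _ a (2 - f) a0 h2 axpi.
have c3l := @scaled_cot_ge0 _ a (1 - f) a0 h0 ltac:(nra).
have c3u := @scaled_cot_le_inv _ a (1 - f) a0 h0 ltac:(nra).
have k6 := le_trans (ler_norm _) (norm_sin_turns_le (2 * pi * f)).
have /andP[k0 k1] := @sin_turns_near0 _ f ltac:(lra).
rewrite mulNr; move: (sin _ / _) k6 k0 k1 => k k6 k0 k1.
move: (scaled_cot a f) (scaled_cot a (2 - f)) (scaled_cot a (1 - f))
  c1u c1l c2u c2l c3l c3u.
move=> c1 c2 c3 c1u c1l c2u c2l c3l c3u.
have iE : (1 - f)^-1 / 2 - (2 - f)^-1 = f / (2 * (1 - f) * (2 - f)).
  by field; rewrite !gt_eqF.
have i1 : f / (2 * (1 - f) * (2 - f)) <= f * (47 / 100).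
  by rewrite ler_pdivrMr ?mulr_gt0//; nra.
have i2 : (2 - f)^-1 <= 1 by rewrite invf_le1//; lra.
have ea : a ^+ 2 * (2 - f) / 8 <= 2 / 7 * f.
  by have := sqr_ge0 a; nra.
have kc : k * c1 <= 1 - 2 * f ^+ 2.
  apply: (@le_trans _ _ (f * (1 - 2 * f ^+ 2) * f^-1)); first exact: ler_pM.
  by rewrite mulrAC divff ?mul1r ?gt_eqF.
have kf : k <= f by nra.
have kd : k * (c3 / 2 - c2) <= f * (76 / 100 * f).
  have [d0|d0] := leP 0 (c3 / 2 - c2); last by nra.
  by apply: ler_pM; lra.
apply/andP; split; last by nra.
have : k * c2 <= 6^-1 * 1 by have [?|?] := leP 0 c2; [apply: ler_pM; lra|nra].
have : 0 <= k * c1 by apply: mulr_ge0.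
have : 0 <= k * c3 by apply: mulr_ge0.
by lra.
Qed.

(** The rate is stated in terms of y, the exact frequency, and the gain in terms
    of x, the leapfrog frequency; x >= y. Above the resonance this only helps.
    Below it, the shift uses up at most an eighth of the gap, and for the same
    reason y < 1 < x cannot occur. *)
Lemma filter_gain_le_rate {R : realType} (M : nat) (a x y delta : R) :
  (0 < M)%N -> a = 2 * pi / M%:R -> a <= 1 -> a <= delta -> delta <= `|y - 1| ->
  0 < x -> a * (x + 1) <= pi -> sin (a * x / 2) = a * y / 2 ->
  `|filter_gain a M (x * a)| <= Num.max (1 - 3 / 10 * delta ^+ 2) (6 / 10).
Proof.
move=> M0 aE a1 ad dy x0 axpi sE.
have a0 : 0 < a by rewrite aE divr_gt0 ?ltr0n// mulr_gt0 ?pi_gt0.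
have [yx xy] := @frequency_shift _ a x y a0 x0 ltac:(lra) sE.
rewrite le_max; apply/orP.
have [xs|xl] := leP x (65 / 100).
  by right; apply: filter_gain_far_left => //; rewrite x0.
have [xs|xr] := leP (135 / 100) x; first by right; apply: filter_gain_far_right.
suff /andP[gl gr] :
    - (6 / 10) <= filter_gain a M (x * a) <= 1 - 3 / 10 * delta ^+ 2.
  have [g0|g0] := leP 0 (filter_gain a M (x * a)); [left|right].
    by rewrite ger0_norm.
  by rewrite ltr0_norm//; lra.
have aa : a ^+ 2 <= delta by nra.
have [x1|x1] := leP x 1.
  have d8 : delta <= (1 - x) + delta / 8.
    move: dy; rewrite ler0_norm; last by lra.
    have : x ^+ 3 <= 1 by rewrite exprn_ile1// ltW.
    have := sqr_ge0 a.
    by nra.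
  have := @filter_gain_near_left _ M a (1 - x) M0 aE
    ltac:(lra) ltac:(lra) ltac:(lra).
  rewrite (_ : 2 - (1 - x) = x + 1); last by ring.
  rewrite (_ : 1 - (1 - x) = x); last by ring.
  move=> /(_ axpi)/andP[gl gr]; rewrite gl /=; apply: le_trans gr _.
  by nra.
have [y1|y1] := leP 1 y.
  move: dy; rewrite ger0_norm ?subr_ge0// => dy.
  have := @filter_gain_near_right _ M a (x - 1) M0 aE a1 ltac:(lra) ltac:(lra).
  rewrite (_ : 1 + (x - 1) = x); last by ring.
  move=> /(_ axpi)/andP[gl gr]; rewrite gl /=; apply: le_trans gr _.
  by nra.
have : delta <= delta * (1 / 2).
  move: dy; rewrite ltr0_norm ?subr_lt0// => dy.
  have x3 : x ^+ 3 <= 4.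
    apply: le_trans (_ : (135 / 100) ^+ 3 <= _); last by lra.
    by rewrite lerXn2r ?nnegrE//; lra.
  have := sqr_ge0 a.
  by nra.
by lra.
Qed.

(** Take theta = 2 arcsin(a y / 2). The time step restriction puts a y / 2 below
    1 - a / pi, hence below cos(a/2) = sin(pi/2 - a/2), which is to say
    theta + a <= pi. *)
Lemma discrete_frequency {R : realType} (M : nat) (a y delta : R) : (0 < M)%N ->
  a = 2 * pi / M%:R -> a <= 1 -> a <= delta -> delta <= `|y - 1| ->
  0 < y -> a * y + 2 * a / pi <= 2 ->
  exists2 theta : R, cos theta = 1 - (a * y) ^+ 2 / 2 &
    `|filter_gain a M theta| <= Num.max (1 - 3 / 10 * delta ^+ 2) (6 / 10).
Proof.
move=> M0 aE a1 ad dy y0 cfl.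
have a0 : 0 < a by rewrite aE divr_gt0 ?ltr0n// mulr_gt0 ?pi_gt0.
have p3 := pi_ge3 R; have p4 := pi_lt4 R.
have ay0 : 0 < a * y by rewrite mulr_gt0.
have pos : 0 < a / pi by rewrite divr_gt0 ?pi_gt0.
have b1 : a * y / 2 <= 1 by lra.
pose t : R := asin (a * y / 2).
have st : sin t = a * y / 2.
  by apply: asinK; rewrite in_itv /=; apply/andP; split; lra.
have tl : - (pi / 2) <= t by apply: asin_geNpi2; apply/andP; split; lra.
have tu : t <= pi / 2 by apply: asin_lepi2; apply/andP; split; lra.
have t0 : 0 < t.
  rewrite -(@ltr_sin R); last first.
  - by rewrite in_itv /= tl tu.
  - by rewrite in_itv /=; apply/andP; split; lra.
  by rewrite sin0 st; lra.
have ta : t <= pi / 2 - a / 2.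
  rewrite leNgt -(@ltr_sin R); last first.
  - by rewrite in_itv /= tl tu.
  - by rewrite in_itv /=; apply/andP; split; lra.
  rewrite -leNgt; have -> : sin (pi / 2 - a / 2) = cos (a / 2).
    by rewrite sinB sin_pihalf cos_pihalf; ring.
  rewrite st; apply: le_trans (cos_ge_quad _).
  have : a / 4 <= a / pi by rewrite ler_wpM2l ?(ltW a0)// lef_pV2 ?posrE; lra.
  by nra.
exists (2 * t).
  by rewrite cos_double (_ : 2 * t / 2 = t) ?st; field.
have -> : 2 * t = 2 * t / a * a by rewrite divfK ?gt_eqF.
have xE : a * (2 * t / a) = 2 * t by rewrite mulrC divfK ?gt_eqF.
apply: (@filter_gain_le_rate _ M a _ y) => //.
- by rewrite divr_gt0// mulr_gt0.
- by rewrite mulrDr xE; lra.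
- by rewrite xE (_ : 2 * t / 2 = t); last by field.
Qed.

(** * Expansion in eigenvectors *)

Lemma linear_map_sum {K : fieldType} {U : lmodType K} {L : U -> U}
    (hL : forall a u v, L (a *: u + v) = a *: L u + L v)
    (I : Type) (r : seq I) (c : I -> K) (f : I -> U) :
  L (\sum_(i <- r) c i *: f i) = \sum_(i <- r) c i *: L (f i).
Proof.
have L0 : L 0 = 0.
  by have := hL (-1) 0 0; rewrite scaler0 addr0 scaleN1r addNr.
elim: r => [|i r IH]; first by rewrite !big_nil.
by rewrite !big_cons hL IH.
Qed.

(** Applying L - mu_k to a relation removes its k-th term and multiplies the
    others by mu_i - mu_k, which is nonzero. *)
Lemma eigenvectors_independent {K : fieldType} {U : lmodType K} {L : U -> U}
    (hL : forall a u v, L (a *: u + v) = a *: L u + L v)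
    {I : eqType} {mu : I -> K} {psi : I -> U} :
  injective mu -> (forall i, psi i != 0) ->
  (forall i, L (psi i) = mu i *: psi i) ->
  forall (r : seq I) (c : I -> K), uniq r ->
    \sum_(i <- r) c i *: psi i = 0 -> {in r, forall i, c i = 0}.
Proof.
move=> mu_inj psi0 Lpsi; elim=> [//|k r IH] c /= /andP[kr ur] sum0.
have c0 : {in r, forall i, c i = 0}.
  have sum1 : \sum_(i <- r) (c i * (mu i - mu k)) *: psi i = 0.
    have : L (\sum_(i <- k :: r) c i *: psi i)
           - mu k *: (\sum_(i <- k :: r) c i *: psi i) = 0.
      have L0 : L 0 = 0.
        by have := hL (-1) 0 0; rewrite scaler0 addr0 scaleN1r addNr.
      by rewrite sum0 L0 scaler0 subr0.
    rewrite (linear_map_sum hL) scaler_sumr -sumrB big_cons Lpsi.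
    rewrite !scalerA mulrC subrr add0r => {2}<-.
    apply: eq_bigr => i _.
    by rewrite Lpsi !scalerA -scalerBl mulrBr [mu k * _]mulrC.
  move=> i ir; have /eqP := IH _ ur sum1 i ir.
  rewrite mulf_eq0 subr_eq0 => /orP[/eqP //|/eqP/mu_inj ik].
  by rewrite -ik ir in kr.
have ck : c k = 0.
  move: sum0; rewrite big_cons big_seq big1 => [|i ir]; last first.
    by rewrite c0// scale0r.
  rewrite addr0 => /eqP; rewrite scaler_eq0 (negPf (psi0 k)) orbF.
  by move/eqP.
by move=> i; rewrite in_cons => /predU1P[->|/c0].
Qed.

Lemma eigenbasis_expansion {K : fieldType} {U : vectType K} {V : {vspace U}}
    {L : U -> U} (hL : forall a u v, L (a *: u + v) = a *: L u + L v)
    {n : nat} {mu : 'I_n -> K} {psi : 'I_n -> U} :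
  injective mu -> (forall i, psi i != 0) ->
  (forall i, L (psi i) = mu i *: psi i) ->
  (forall i, psi i \in V) -> \dim V = n ->
  forall v, v \in V -> exists c : 'I_n -> K, v = \sum_i c i *: psi i.
Proof.
move=> mu_inj psi0 Lpsi psiV dimV v vV.
pose X := [tuple psi i | i < n].
have Xi (i : 'I_n) : X`_i = psi i by rewrite -tnth_nth tnth_mktuple.
have fX : free X.
  apply/freeP => k; under eq_bigr do rewrite Xi.
  move=> /(eigenvectors_independent hL mu_inj psi0 Lpsi _ _
    (index_enum_uniq _)) k0 i.
  by apply: k0; rewrite mem_index_enum.
have bX : basis_of V X.
  rewrite basisEfree fX size_tuple dimV leqnn andbT /=.
  apply/span_subvP => _ /mapP[i _ ->]; exact: psiV.
exists (fun i => coord X i v); rewrite {1}(coord_basis bX vV).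
by apply: eq_bigr => i _; rewrite Xi.
Qed.

(** * The scheme as a second-order recurrence *)

Definition curl {R : realType} {nx ny : nat} (G : yee_grid R nx ny)
    (Hx : yedges R nx ny) (Hy : xedges R nx ny) (i j : nat) : R :=
  (pt Hy i j - pt Hy i.-1 j) / dx G - (pt Hx i j - pt Hx i j.-1) / dy G.

Lemma pt_lin {R : realType} {p q : nat} (a : R) (u v : 'M[R]_(p.+1, q.+1)) i j :
  pt (a *: u + v) i j = a * pt u i j + pt v i j.
Proof. by rewrite /pt !mxE. Qed.

Lemma pt_faraday_x {R : realType} {nx ny : nat} (G : yee_grid R nx ny) F i j :
  (i <= nx.+1)%N -> (j <= ny)%N ->
  pt (faraday_x G F) i j = - ((pt (muy G) i j)^-1 * Dy G F i j).
Proof. by move=> ile jle; rewrite {1}/pt mxE !inordK. Qed.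

Lemma pt_faraday_y {R : realType} {nx ny : nat} (G : yee_grid R nx ny) F i j :
  (i <= nx)%N -> (j <= ny.+1)%N ->
  pt (faraday_y G F) i j = (pt (mux G) i j)^-1 * Dx G F i j.
Proof. by move=> ile jle; rewrite {1}/pt mxE !inordK. Qed.

Lemma pt_eq {R : realType} {p q : nat} (A B : 'M[R]_(p.+1, q.+1)) :
  (forall i j, (i <= p)%N -> (j <= q)%N -> pt A i j = pt B i j) -> A = B.
Proof.
move=> AB; apply/matrixP => i j.
by have := AB i j (ltn_ord i) (ltn_ord j); rewrite /pt !inord_val.
Qed.

(** The magnetic update followed by the curl in the electric update is -L_h, up
    to the factor eps. *)
Lemma curl_faraday {R : realType} {nx ny : nat} (G : yee_grid R nx ny) F i j :
  update_point nx ny i j ->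
  curl G (faraday_x G F) (faraday_y G F) i j =
  pt (eps G) i j * minus_Lh G F i j.
Proof.
move=> /andP[/andP[i0 inx] /andP[j0 jny]].
have i1 : (i.-1 <= nx)%N by rewrite (leq_trans (leq_pred i)).
have j1 : (j.-1 <= ny)%N by rewrite (leq_trans (leq_pred j)).
have [i2 j2] : (i <= nx.+1)%N /\ (j <= ny.+1)%N by split; exact: leqW.
rewrite /curl !pt_faraday_x ?pt_faraday_y//.
rewrite /minus_Lh /Dx /Dy !prednK//.
have e0 : pt (eps G) i j != 0 by rewrite gt_eqF ?eps_gt0.
have m1 : pt (mux G) i j != 0 by rewrite gt_eqF ?mux_gt0.
have m2 : pt (mux G) i.-1 j != 0 by rewrite gt_eqF ?mux_gt0.
have m3 : pt (muy G) i j != 0 by rewrite gt_eqF ?muy_gt0.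
have m4 : pt (muy G) i j.-1 != 0 by rewrite gt_eqF ?muy_gt0.
have d1 : dx G != 0 by rewrite gt_eqF ?dx_gt0.
have d2 : dy G != 0 by rewrite gt_eqF ?dy_gt0.
move: (pt (eps G) i j) (pt (mux G) i j) (pt (mux G) i.-1 j) (pt (muy G) i j)
  (pt (muy G) i j.-1) (dx G) (dy G) e0 m1 m2 m3 m4 d1 d2.
move=> e ax bx ay by_ hx hy e0 m1 m2 m3 m4 d1 d2.
move: (pt F i.+1 j) (pt F i j) (pt F i.-1 j) (pt F i j.+1) (pt F i j.-1).
move=> f1 f2 f3 f4 f5.
by field; rewrite e0 m1 m2 m3 m4 d1 d2.
Qed.

Lemma curl_lin {R : realType} {nx ny : nat} (G : yee_grid R nx ny)
    a Hx Hy Kx Ky i j :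
  curl G (a *: Hx + Kx) (a *: Hy + Ky) i j =
  a * curl G Hx Hy i j + curl G Kx Ky i j.
Proof. by rewrite /curl !pt_lin; ring. Qed.

Lemma bc_extension {R : realType} {nx ny : nat}
    {G : yee_grid R nx ny} {bc : yee_bc R nx ny}
    (f : nat -> nat -> R) : bc_closes G bc ->
  exists F, F \in bcE bc /\
    forall i j, update_point nx ny i j -> pt F i j = f i j.
Proof.
move=> [ext _]; have [F [[FV FE] _]] := ext (\matrix_(i, j) f i j).
exists F; split=> // i j ij; rewrite FE // /pt mxE.
case/andP: ij => /andP[_ ile] /andP[_ jle].
by rewrite !inordK// ltnS leqW.
Qed.

Lemma bc_determined {R : realType} {nx ny : nat}
    {G : yee_grid R nx ny} {bc : yee_bc R nx ny}
    {F1 F2 : nodes R nx ny} : bc_closes G bc ->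
  F1 \in bcE bc -> F2 \in bcE bc ->
  (forall i j, update_point nx ny i j -> pt F1 i j = pt F2 i j) -> F1 = F2.
Proof.
move=> [ext _] V1 V2 E12; have [F [_ uF]] := ext F2.
by rewrite -(uF F1 (conj V1 E12)); apply: uF.
Qed.

Lemma LhP {R : realType} {nx ny : nat}
    {G : yee_grid R nx ny} {bc : yee_bc R nx ny}
    (F : nodes R nx ny) : bc_closes G bc ->
  Lh G bc F \in bcE bc /\
  forall i j, update_point nx ny i j -> - pt (Lh G bc F) i j = minus_Lh G F i j.
Proof.
move=> hbc.
have [V [VV VE]] := bc_extension (fun i j => - minus_Lh G F i j) hbc.
apply: (xgetPex 0 (P := [set V | V \in bcE bc /\
    forall i j, update_point nx ny i j -> - pt V i j = minus_Lh G F i j])).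
by exists V; split=> // i j ij; rewrite VE// opprK.
Qed.

Lemma Lh_linear {R : realType} {nx ny : nat}
    {G : yee_grid R nx ny} {bc : yee_bc R nx ny} :
  bc_closes G bc -> forall a u v,
  Lh G bc (a *: u + v) = a *: Lh G bc u + Lh G bc v.
Proof.
move=> hbc a u v.
have [Vu Eu] := LhP u hbc; have [Vv Ev] := LhP v hbc.
have [V E] := LhP (a *: u + v) hbc.
apply: (bc_determined hbc V); first by rewrite memvD// memvZ.
move=> i j ij; apply: oppr_inj; rewrite E// pt_lin opprD -mulrN Eu// Ev//.
by rewrite /minus_Lh !pt_lin; ring.
Qed.

Lemma pt0 {R : realType} {p q : nat} i j : pt (0 : 'M[R]_(p.+1, q.+1)) i j = 0.
Proof. by rewrite /pt mxE. Qed.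

Lemma ptD {R : realType} {p q : nat} (u v : 'M[R]_(p.+1, q.+1)) i j :
  pt (u + v) i j = pt u i j + pt v i j.
Proof. by rewrite /pt mxE. Qed.

Lemma ptN {R : realType} {p q : nat} (u : 'M[R]_(p.+1, q.+1)) i j :
  pt (- u) i j = - pt u i j.
Proof. by rewrite /pt mxE. Qed.

Lemma ptZ {R : realType} {p q : nat} (a : R) (u : 'M[R]_(p.+1, q.+1)) i j :
  pt (a *: u) i j = a * pt u i j.
Proof. by rewrite /pt mxE. Qed.

(** Two consecutive electric updates differ by the curl of one magnetic update,
    that is by -L_h E. The half level at -1/2 is half a magnetic update
    backwards, so the first step carries dt^2 / 2 instead of dt^2. *)
Lemma yee_second_order {R : realType} {nx ny : nat} {G : yee_grid R nx ny}
    {bc : yee_bc R nx ny} {w dt : R} {J nu : nodes R nx ny}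
    {E : nat -> nodes R nx ny} :
  0 < dt -> bc_closes G bc -> over_eps G J \in bcE bc ->
  yee_solution G bc w dt J nu E ->
  [/\ E 0%N = nu,
      E 1%N = nu - (dt ^+ 2 / 2) *: (Lh G bc nu + w *: over_eps G J) &
      forall n, E n.+2 = 2 *: E n.+1 - E n - dt ^+ 2 *:
        (Lh G bc (E n.+1) + (w * cos (w * (n.+1%:R * dt))) *: over_eps G J)].
Proof.
move=> dt0 hbc JV [Hx [Hy [[EV HV hE hHx hHy] E0 hx0 hy0]]].
have dtn0 : dt != 0 by rewrite gt_eqF.
have HxS n : Hx n.+1 = dt *: faraday_x G (E n) + Hx n.
  apply: pt_eq => i j ile jle; rewrite pt_lin pt_faraday_x//.
  by apply/eqP; rewrite -subr_eq -(divfK dtn0 (_ - _)) hHx// mulrC.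
have HyS n : Hy n.+1 = dt *: faraday_y G (E n) + Hy n.
  apply: pt_eq => i j ile jle; rewrite pt_lin pt_faraday_y//.
  by apply/eqP; rewrite -subr_eq -(divfK dtn0 (_ - _)) hHy// mulrC.
have Hx0 : Hx 0%N = (- (dt / 2)) *: faraday_x G nu + 0.
  apply: pt_eq => i j ile jle; rewrite hx0// pt_lin pt_faraday_x//.
  by rewrite pt0 addr0 mulrNN invfM /Dy !mulrA.
have Hy0 : Hy 0%N = (- (dt / 2)) *: faraday_y G nu + 0.
  apply: pt_eq => i j ile jle; rewrite hy0// pt_lin pt_faraday_y//.
  by rewrite pt0 addr0 mulNr invfM /Dx !mulrA.
have e0 i j : pt (eps G) i j != 0 by rewrite gt_eqF ?eps_gt0.
have ptJ i j : pt (over_eps G J) i j = pt J i j / pt (eps G) i j.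
  by rewrite /pt mxE.
have amp n i j : update_point nx ny i j ->
    pt (E n.+1) i j = pt (E n) i j + dt / pt (eps G) i j *
      (curl G (Hx n.+1) (Hy n.+1) i j - yee_source w dt n * pt J i j).
  by move=> ij; rewrite /curl -hE//; field; rewrite dtn0 e0.
have ptL F i j : update_point nx ny i j ->
    pt (Lh G bc F) i j = - minus_Lh G F i j.
  by move=> ij; rewrite -(LhP F hbc).2// opprK.
have LV F := (LhP F hbc).1.
split=> //.
- apply: (bc_determined hbc (EV _)).
    by rewrite -E0 memvB ?EV// memvZ// memvD ?memvZ ?LV.
  move=> i j ij.
  rewrite amp// HxS HyS Hx0 Hy0 E0 !curl_lin curl_faraday// /=.
  rewrite !(ptD, ptN, ptZ) ptL// ptJ.
  have -> : curl G 0 0 i j = 0 by rewrite /curl !pt0 !subrr !mul0r subrr.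
  by field.
move=> n; apply: (bc_determined hbc (EV _)).
  by rewrite memvB ?memvB ?memvZ ?EV// memvD ?memvZ ?LV.
move=> i j ij.
rewrite !(ptD, ptN, ptZ) ptL// ptJ.
rewrite amp// HxS HyS curl_lin curl_faraday// /=.
have -> : curl G (Hx n.+1) (Hy n.+1) i j =
    pt (eps G) i j / dt * (pt (E n.+1) i j - pt (E n) i j)
      + yee_source w dt n * pt J i j.
  by rewrite amp//; field; rewrite dtn0 e0.
by field; rewrite dtn0 e0.
Qed.

(** The fields E^n and (H_x, H_y)^(n-1/2), computed step by step; the boundary
    values of E are chosen through its membership of bcE. *)
Fixpoint yee_state {R : realType} {nx ny : nat} (G : yee_grid R nx ny)
    (bc : yee_bc R nx ny) (dt : R) (S : nat -> R) (J nu : nodes R nx ny)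
    (n : nat) : nodes R nx ny * (yedges R nx ny * xedges R nx ny) :=
  if n is m.+1 then
    let: (E, H) := yee_state G bc dt S J nu m in
    let H' := dt *: (faraday_x G E, faraday_y G E) + H in
    (xget 0 [set F | F \in bcE bc /\
       forall i j, update_point nx ny i j ->
         pt F i j = pt E i j + dt / pt (eps G) i j *
           (curl G H'.1 H'.2 i j - S m * pt J i j)],
     H')
  else (nu, (- (dt / 2)) *: (faraday_x G nu, faraday_y G nu)).

Lemma yee_solution_exists {R : realType} {nx ny : nat} (G : yee_grid R nx ny)
    (bc : yee_bc R nx ny) (w dt : R) (J nu : nodes R nx ny) :
  0 < dt -> bc_closes G bc -> nu \in bcE bc ->
  exists E, yee_solution G bc w dt J nu E.
Proof.
move=> dt0 hbc nuV.
have dtn0 : dt != 0 by rewrite gt_eqF.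
pose st := yee_state G bc dt (yee_source w dt) J nu.
have stH n : (st n.+1).2 = dt *: (faraday_x G (st n).1, faraday_y G (st n).1)
                           + (st n).2.
  by rewrite {1}/st /= -/(st n); case: (st n).
have stE n : (st n.+1).1 \in bcE bc /\ forall i j, update_point nx ny i j ->
    pt (st n.+1).1 i j = pt (st n).1 i j + dt / pt (eps G) i j *
      (curl G (st n.+1).2.1 (st n.+1).2.2 i j - yee_source w dt n * pt J i j).
  rewrite stH {1 2}/st /= -/(st n); case: (st n) => E H /=.
  have [V VP] := bc_extension (fun i j => pt E i j + dt / pt (eps G) i j *
      (curl G (dt *: faraday_x G E + H.1) (dt *: faraday_y G E + H.2) i j
       - yee_source w dt n * pt J i j)) hbc.
  by apply: (xgetPex 0 (P := [set F | F \in bcE bc /\ _])); exists V.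
have EV n : (st n).1 \in bcE bc by case: n => [//|n]; case: (stE n).
have HV n : (st n).2 \in bcH bc.
  elim: n => [|n IH]; first by rewrite memvZ// hbc.2.
  by rewrite stH memvD// memvZ// hbc.2.
exists (fun n => (st n).1), (fun n => (st n).2.1), (fun n => (st n).2.2).
have e0 i j : pt (eps G) i j != 0 by rewrite gt_eqF ?eps_gt0.
split=> //; first split=> //.
- by move=> n; rewrite -surjective_pairing.
- move=> n i j ij; rewrite (stE n).2//.
  rewrite -/(curl G (st n.+1).2.1 (st n.+1).2.2 i j).
  by field; rewrite dtn0 e0.
- move=> n i j ile jle; rewrite stH /= pt_lin pt_faraday_x// addrK.
  by rewrite [LHS]mulrAC divff// mul1r.
- move=> n i j ile jle; rewrite stH /= pt_lin pt_faraday_y// addrK.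
  by rewrite [LHS]mulrAC divff// mul1r.
- move=> i j ile jle; rewrite /= -[_ *: _]addr0 pt_lin pt_faraday_x//.
  by rewrite pt0 addr0 mulrNN invfM /Dy !mulrA.
- move=> i j ile jle; rewrite /= -[_ *: _]addr0 pt_lin pt_faraday_y//.
  by rewrite pt0 addr0 mulNr invfM /Dx !mulrA.
Qed.

Lemma yee_evolutionP {R : realType} {nx ny : nat} {G : yee_grid R nx ny}
    {bc : yee_bc R nx ny} (w : R) {dt : R} (J : nodes R nx ny)
    {nu : nodes R nx ny} :
  0 < dt -> bc_closes G bc -> nu \in bcE bc ->
  yee_solution G bc w dt J nu (yee_evolution G bc w dt J nu).
Proof. by move=> ? ? ?; apply: xgetPex; exact: yee_solution_exists. Qed.

(** * Evolution and filtering of the modes *)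

Lemma cos_three_term {R : realType} (t : R) (n : nat) :
  cos (n.+2%:R * t) = 2 * cos t * cos (n.+1%:R * t) - cos (n%:R * t).
Proof.
have -> : n.+2%:R * t = n.+1%:R * t + t by rewrite -[n.+2%:R]natr1; ring.
have -> : n%:R * t = n.+1%:R * t - t by rewrite -[n.+1%:R]natr1; ring.
by rewrite cosB cosD; ring.
Qed.

(** Both cos(n a) uinf and the cos(n theta_j) psi_j satisfy the three-term
    recurrence for cosines; the first absorbs the whole forcing, by the first
    hypothesis. *)
Lemma leapfrog_modes {R : realType} {U : lmodType R} {L : U -> U}
    (hL : forall a u v, L (a *: u + v) = a *: L u + L v)
    {a dt w : R} {f uinf : U} {n : nat} {lam theta c : 'I_n -> R}
    {psi : 'I_n -> U} {E : nat -> U} :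
  dt ^+ 2 *: (L uinf + w *: f) = (2 - 2 * cos a) *: uinf ->
  (forall j, L (psi j) = lam j ^+ 2 *: psi j) ->
  (forall j, cos (theta j) = 1 - (dt * lam j) ^+ 2 / 2) ->
  E 0%N = uinf + \sum_j c j *: psi j ->
  E 1%N = E 0%N - (dt ^+ 2 / 2) *: (L (E 0%N) + w *: f) ->
  (forall m, E m.+2 = 2 *: E m.+1 - E m
     - dt ^+ 2 *: (L (E m.+1) + (w * cos (m.+1%:R * a)) *: f)) ->
  forall m, E m = cos (m%:R * a) *: uinf
                  + \sum_j (c j * cos (m%:R * theta j)) *: psi j.
Proof.
move=> huinf hpsi htheta E0 E1 ES.
(* One increment of the recurrence in coordinates: s is 1/2 at the start and 1
   afterwards. *)
have step s k e (F : U) : F = k *: uinf + \sum_j e j *: psi j ->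
    (dt ^+ 2 * s) *: (L F + (w * k) *: f) =
    (s * k * (2 - 2 * cos a)) *: uinf
    + \sum_j (s * e j * (2 - 2 * cos (theta j))) *: psi j.
  move=> ->; rewrite hL (linear_map_sum hL) addrAC.
  have -> : (w * k) *: f = k *: (w *: f) by rewrite scalerA mulrC.
  rewrite -scalerDr [LHS]scalerDr scalerA.
  have -> : dt ^+ 2 * s * k = s * k * dt ^+ 2 by ring.
  rewrite -(scalerA (s * k)) huinf scalerA scaler_sumr; congr (_ + _).
  by apply: eq_bigr => j _; rewrite hpsi htheta !scalerA; congr (_ *: _); field.
have h0 : E 0%N = cos (0%:R * a) *: uinf
                  + \sum_j (c j * cos (0%:R * theta j)) *: psi j.
  rewrite E0 mul0r cos0 scale1r; congr (_ + _); apply: eq_bigr => j _.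
  by rewrite mul0r cos0 mulr1.
suff h m : (E m = cos (m%:R * a) *: uinf
             + \sum_j (c j * cos (m%:R * theta j)) *: psi j) /\
           (E m.+1 = cos (m.+1%:R * a) *: uinf
             + \sum_j (c j * cos (m.+1%:R * theta j)) *: psi j).
  by move=> m; case: (h m).
elim: m => [|m [IH0 IH1]]; split=> //.
  rewrite E1 -[w in w *: f]mulr1 (step 2^-1 1 c) ?E0 ?scale1r//.
  rewrite mul1r opprD addrACA -sumrB; congr (_ + _).
    by rewrite -{1}[uinf]scale1r -scalerBl; congr (_ *: _); field.
  apply: eq_bigr => j _; rewrite -scalerBl mul1r; congr (_ *: _).
  by field.
rewrite ES -[dt ^+ 2]mulr1 (step 1 _ _ _ IH1) IH1 IH0.
rewrite scalerDr !opprD (addrACA (2 *: _)) [LHS]addrACA scaler_sumr.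
rewrite -!sumrB scalerA -!scalerBl; congr (_ + _).
  by congr (_ *: _); rewrite cos_three_term; ring.
apply: eq_bigr => j _; rewrite scalerA -!scalerBl; congr (_ *: _).
by rewrite cos_three_term; ring.
Qed.

Lemma Pi_h_modes {R : realType} {nx ny : nat} {G : yee_grid R nx ny}
    {bc : yee_bc R nx ny} {w T dt : R} {M : nat} {J nu uinf : nodes R nx ny}
    {n : nat} {theta c : 'I_n -> R} {psi : 'I_n -> nodes R nx ny} :
  (0 < M)%N -> 0 < T -> dt = T / M%:R ->
  (forall m, yee_evolution G bc w dt J nu m =
     cos (m%:R * (w * dt)) *: uinf
     + \sum_j (c j * cos (m%:R * theta j)) *: psi j) ->
  Pi_h G bc w T dt M J nu =
    filter_gain (w * dt) M (w * dt) *: uinf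
    + \sum_j (c j * filter_gain (w * dt) M (theta j)) *: psi j.
Proof.
move=> M0 T0 dtE hE; rewrite /Pi_h.
have -> : 2 * dt / T = 2 / M%:R.
  by rewrite dtE; field; rewrite !gt_eqF// ltr0n.
under eq_bigr => m _.
  rewrite hE scalerDr scalerA scaler_sumr.
  under eq_bigr do rewrite scalerA.
  over.
rewrite big_split exchange_big /= scalerDr; congr (_ + _).
  rewrite -scaler_suml scalerA; congr (_ *: _); rewrite /filter_gain.
  congr (_ * _).
  by apply: eq_bigr => m _; rewrite (mulrCA w) [RHS]mulrA.
rewrite scaler_sumr; apply: eq_bigr => j _.
rewrite -scaler_suml scalerA; congr (_ *: _); rewrite /filter_gain [RHS]mulrCA.
congr (_ * _); rewrite mulr_sumr; apply: eq_bigr => m _.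
by rewrite (mulrCA w); ring.
Qed.

Lemma norm_expansion_le {R : realType} {nx ny : nat}
    {V : {vspace nodes R nx ny}} {nrm : nodes R nx ny -> R}
    {n : nat} (c : 'I_n -> R) {psi : 'I_n -> nodes R nx ny} :
  is_norm_on V nrm -> (forall j, psi j \in V) ->
  nrm (\sum_j c j *: psi j) <= \sum_j `|c j| * nrm (psi j).
Proof.
move=> [_ _ nZ nD] pV.
suff : nrm (\sum_j c j *: psi j) <= \sum_j `|c j| * nrm (psi j) /\
       \sum_j c j *: psi j \in V by case.
elim/big_ind2: _ => [|u1 s1 u2 s2 [h1 v1] [h2 v2]|j _].
- rewrite mem0v; split=> //.
  by have := nZ 0 0 (mem0v _); rewrite scaler0 normr0 mul0r => ->.
- by split; [apply: le_trans (nD _ _ v1 v2) (lerD h1 h2)|exact: memvD].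
- by rewrite nZ// memvZ.
Qed.

Lemma geometric_bound_cvg0 {R : realType} (u : nat -> R) (rho C : R) :
  0 <= rho < 1 -> (forall k, 0 <= u k <= C * rho ^+ k) ->
  (u @ \oo --> (0 : R)) /\
  (u : nat -> R^o) =O_\oo (fun k => rho ^+ k : R^o).
Proof.
move=> /andP[r0 r1] hu; split.
  apply: (@squeeze_cvgr _ _ _ _ (fun=> 0) (fun k => C * rho ^+ k)).
  - by apply: nearW => k; exact: hu.
  - exact: cvg_cst.
  - rewrite -(mulr0 C); apply: cvgMr.
    by apply: cvg_expr; rewrite ger0_norm.
apply/eqO_exP; exists (Num.max C 1); first by rewrite lt_max ltr01 orbT.
apply: nearW => k; have /andP[u0 uC] := hu k.
rewrite /= !ger0_norm ?exprn_ge0//; apply: le_trans uC _.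
by rewrite ler_wpM2r ?exprn_ge0// le_max lexx.
Qed.

Theorem theorem1 (R : realType) (nx ny : nat)
  (G : yee_grid R nx ny) (bc : yee_bc R nx ny)
  (w T dt wt : R) (M : nat) (J nuinf : nodes R nx ny)
  (N : nat) (lam : 'I_N.+1 -> R) (psi : 'I_N.+1 -> nodes R nx ny)
  (delta rho : R) (nrm : nodes R nx ny -> R)
  (hw : 0 < w) (hT : T = 2 * pi / w) (hM : (0 < M)%N) (hdt : dt = T / M%:R)
  (hbc : bc_closes G bc) (hen : energy_conserving G bc dt)
  (hnrm : is_norm_on (bcE bc) nrm)
  (hJ : over_eps G J \in bcE bc)
  (hwt : wt = sin (w * dt / 2) / (dt / 2))
  (hnuV : nuinf \in bcE bc)
  (hnu : wt ^+ 2 *: nuinf - Lh G bc nuinf = w *: over_eps G J)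
  (hN : \dim (bcE bc) = N.+1)
  (hlam0 : 0 < lam ord0)
  (hlam : forall i j : 'I_N.+1, (i < j)%N -> lam i < lam j)
  (hpsi : forall j, [/\ psi j \in bcE bc, psi j != 0 &
                       - Lh G bc (psi j) = - (lam j ^+ 2) *: psi j])
  (hdelta : delta = resonance_gap lam w) (hdelta0 : 0 < delta)
  (hcfl : dt <= 2 / (lam ord_max + 2 * w / pi))
  (hres : w * dt <= Num.min delta 1)
  (hrho : rho = Num.max (1 - 3 / 10 * delta ^+ 2) (6 / 10)) :
  let nu := fun k : nat => iter k (Pi_h G bc w T dt M J) 0 in
  ((fun k => nrm (nu k - nuinf)) @ \oo --> (0 : R)) /\
  (fun k => nrm (nu k - nuinf) : R^o) =O_\oo (fun k => rho ^+ k : R^o).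
Proof.
move=> nu.
have pi0 := pi_gt0 R.
have M0 : 0 < M%:R :> R by rewrite ltr0n.
have T0 : 0 < T by rewrite hT divr_gt0 ?mulr_gt0.
have dt0 : 0 < dt by rewrite hdt divr_gt0.
have aE : w * dt = 2 * pi / M%:R.
  rewrite hdt hT; move: (pi : R) => p.
  by field; rewrite (gt_eqF M0) (gt_eqF hw).
move: hres; rewrite le_min => /andP[ad a1].
have lam_gt0 j : 0 < lam j.
  have [->//|j0] := eqVneq j ord0.
  by apply: lt_trans hlam0 (hlam _ _ _); rewrite lt0n.
have lam_max j : lam j <= lam ord_max.
  have [->//|jN] := eqVneq j ord_max.
  by apply/ltW/hlam; rewrite ltn_neqAle jN -ltnS ltn_ord.
have lam_inj : injective (fun j => lam j ^+ 2).
  move=> i j /eqP; rewrite eqrXn2 ?ltW// => /eqP lamE.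
  by apply/val_inj; case: (ltngtP i j) => // /hlam; rewrite lamE ltxx.
have Lpsi j : Lh G bc (psi j) = lam j ^+ 2 *: psi j.
  by case: (hpsi j) => _ _ /eqP; rewrite scaleNr eqr_opp => /eqP.
have gap j : delta <= `|lam j / w - 1|.
  have -> : lam j / w - 1 = (lam j - w) / w by rewrite mulrBl divff ?gt_eqF.
  rewrite normrM normfV (gtr0_norm hw) hdelta; exact: bigmin_le.
have cfl j : w * dt * (lam j / w) + 2 * (w * dt) / pi <= 2.
  have den0 : 0 < lam ord_max + 2 * w / pi.
    by rewrite addr_gt0 ?lam_gt0// divr_gt0// mulr_gt0.
  move: hcfl; rewrite ler_pdivlMr// => cflN.
  apply: le_trans cflN; rewrite mulrDr; apply: lerD.
    rewrite (_ : w * dt * (lam j / w) = dt * lam j).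
      by rewrite ler_wpM2l// ltW.
    by field; rewrite gt_eqF.
  by rewrite le_eqVlt; apply/orP; left; apply/eqP; ring.
have /choice [theta htheta] : forall j, exists theta : R,
    cos theta = 1 - (dt * lam j) ^+ 2 / 2 /\
    `|filter_gain (w * dt) M theta| <= rho.
  move=> j.
  have [|theta ct gt] := @discrete_frequency _ M (w * dt) (lam j / w) delta
    hM aE a1 ad (gap j) _ (cfl j).
    by rewrite divr_gt0.
  exists theta; split; last by rewrite hrho.
  by rewrite ct; congr (1 - _ ^+ 2 / _); field; rewrite gt_eqF.
(* By the half-angle formula,
   dt^2 wt^2 = 4 sin^2(w dt / 2) = 2 - 2 cos(w dt). *)
have res : dt ^+ 2 *: (Lh G bc nuinf + w *: over_eps G J)
           = (2 - 2 * cos (w * dt)) *: nuinf.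
  rewrite -hnu addrC subrK scalerA hwt cos_double; congr (_ *: _).
  by field; rewrite gt_eqF.
have Pi_modes v c : v \in bcE bc -> v = nuinf + \sum_j c j *: psi j ->
    Pi_h G bc w T dt M J v =
    nuinf + \sum_j (c j * filter_gain (w * dt) M (theta j)) *: psi j.
  move=> vV vE.
  have [E0 E1 ES] :=
    yee_second_order dt0 hbc hJ (yee_evolutionP w J dt0 hbc vV).
  rewrite (Pi_h_modes (uinf := nuinf) (theta := theta) (c := c) (psi := psi))//.
    by rewrite filter_gain_resonant// scale1r.
  apply: (leapfrog_modes (Lh_linear hbc) res Lpsi (fun j => (htheta j).1)).
  - by rewrite E0.
  - by rewrite E0.
  - by move=> m; rewrite ES (mulrCA w).
have psiV j : psi j \in bcE bc by case: (hpsi j).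
have [c cE] : exists c : 'I_N.+1 -> R, - nuinf = \sum_j c j *: psi j.
  apply: (eigenbasis_expansion (Lh_linear hbc) lam_inj _ Lpsi psiV hN).
    by move=> j; case: (hpsi j).
  by rewrite memvN.
have nuE k : nu k \in bcE bc /\ nu k =
    nuinf + \sum_j (c j * filter_gain (w * dt) M (theta j) ^+ k) *: psi j.
  elim: k => [|k [kV kE]].
    split; first exact: mem0v.
    under eq_bigr do rewrite expr0 mulr1.
    by rewrite -cE subrr.
  have kS : nu k.+1 = nuinf
      + \sum_j (c j * filter_gain (w * dt) M (theta j) ^+ k.+1) *: psi j.
    rewrite /nu iterS -/(nu k) (Pi_modes _ _ kV kE); congr (_ + _).
    by apply: eq_bigr => j _; rewrite -mulrA -exprSr.
  split=> //; rewrite kS memvD// memv_suml// => j _; exact: memvZ.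
have [n0 _ _ _] := hnrm.
have rho0 : 0 <= rho by rewrite hrho le_max; apply/orP; right; lra.
have rho1 : rho < 1.
  rewrite hrho gt_max; apply/andP; split; last by lra.
  by have : 0 < delta ^+ 2 by [rewrite exprn_gt0]; lra.
apply: (@geometric_bound_cvg0 _ _ rho (\sum_j `|c j| * nrm (psi j))).
  by rewrite rho0.
move=> k; have [kV kE] := nuE k.
rewrite n0 ?memvB//= kE addrC addKr.
apply: le_trans (norm_expansion_le _ hnrm psiV) _.
rewrite mulr_suml; apply: ler_sum => j _.
rewrite normrM normrX mulrAC ler_wpM2l ?mulr_ge0 ?n0//.
by rewrite lerXn2r ?nnegrE//; case: (htheta j).
Qed.
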